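(* Let $M^6$ be a compact (without boundary) oriented minimal hypersurface of constant scalar curvature in the unit sphere $S^7$ with its round metric, and let $A$ be its shape operator. If $|A|^2>6$, then there exists an eigenvalue $\lambda>12$ of the Laplace operator on $M$ such that $|A|^2=\lambda-6$.
   Context: Hypersurfaces are immersed, and $M$ carries the metric $g$ induced from the round metric of curvature $1$ on $S^7$. If $N$ is the unit normal vector field of $M$ and $\overline{\nabla}$ is the Levi-Civita connection of $S^7$, the shape operator is the self-adjoint map $A:TM\to TM$ with $AX=-\overline{\nabla}_XN$. The quantity $|A|^2$ is its squared length, i.e. the sum of the squares of its eigenvalues. Minimal means that the mean curvature vanishes, i.e. the trace of $A$ is $0$. For such a hypersurface the scalar curvature is $S=30-|A|^2$, so constant scalar curvature means that $|A|^2$ is constant on $M$. The Laplace operator is $\Delta_M=\mathrm{div}\,\nabla$ of $(M,g)$; a number $\lambda$ is an eigenvalue if there is a nonzero smooth function $h$ on $M$ with $\Delta_Mh=-\lambda h$. *)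

(* Defs.v *)
From HB Require Import structures.
From mathcomp Require Import all_boot all_order all_algebra.
From mathcomp Require Import all_classical all_reals all_analysis.

Set Implicit Arguments.
Unset Strict Implicit.
Unset Printing Implicit Defensive.

Import Order.TTheory GRing.Theory Num.Theory.
Import numFieldNormedType.Exports.

Local Open Scope classical_set_scope.
Local Open Scope ring_scope.

Section Calculus.
Variables (R : realType) (d : nat).

Definition partial (i : 'I_d) (f : 'rV[R]_d -> R) : 'rV[R]_d -> R :=
  fun x => 'D_(delta_mx 0 i) f x.

Fixpoint diffn (W : normedModType R) (k : nat) (V : set 'rV[R]_d)
    (f : 'rV[R]_d -> W) : Prop :=
  (forall x, V x -> differentiable f x) /\
  (if k is k'.+1 then forall v : 'rV[R]_d, diffn k' V (fun x => 'D_v f x)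
   else True).

(* Infinite Fréchet differentiability; only meant for open V, so that the
   values of f outside V are irrelevant. *)
Definition smooth_on (W : normedModType R) (V : set 'rV[R]_d)
    (f : 'rV[R]_d -> W) : Prop :=
  forall k, diffn k V f.

End Calculus.

Section Manifolds.
Variables (R : realType) (M : topologicalType) (d : nat).

(* fwd is a homeomorphism from the open set dom onto the open set cod, with
   inverse bwd.  Both maps are total functions whose values off dom and cod
   carry no meaning. *)
Record chart := Chart {
  dom : set M;
  cod : set 'rV[R]_d;
  fwd : M -> 'rV[R]_d;
  bwd : 'rV[R]_d -> M;
  dom_open : open dom;
  cod_open : open cod;
  fwd_cod : forall p, dom p -> cod (fwd p);
  bwd_dom : forall x, cod x -> dom (bwd x);
  fwdK : forall p, dom p -> bwd (fwd p) = p;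
  bwdK : forall x, cod x -> fwd (bwd x) = x;
  fwd_continuous : {within dom, continuous fwd};
  bwd_continuous : {within cod, continuous bwd}
}.

Definition overlap (c c' : chart) : set 'rV[R]_d :=
  [set x | cod c x /\ dom c' (bwd c x)].

Definition transition (c c' : chart) : 'rV[R]_d -> 'rV[R]_d :=
  fwd c' \o bwd c.

Record oriented_atlas := OrientedAtlas {
  index : Type;
  atlas_chart :> index -> chart;
  atlas_cover : forall p, exists i, dom (atlas_chart i) p;
  atlas_smooth : forall i j,
    smooth_on (overlap (atlas_chart i) (atlas_chart j))
              (transition (atlas_chart i) (atlas_chart j));
  atlas_oriented : forall i j x,
    overlap (atlas_chart i) (atlas_chart j) x ->
    0 < \det ('J (transition (atlas_chart i) (atlas_chart j)) x)
}.

Definition smooth_map (W : normedModType R) (At : oriented_atlas) (f : M -> W)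
    : Prop :=
  forall i, smooth_on (cod (At i)) (f \o bwd (At i)).

End Manifolds.

(* Riemannian geometry of a metric g given by its Gram matrices (g_ij) in
   local coordinates. *)
Section LocalRiemannian.
Variables (R : realType) (d : nat) (g : 'rV[R]_d -> 'M[R]_d).

Definition ginv (x : 'rV[R]_d) : 'M[R]_d := invmx (g x).

(* Gamma^k_ij of the Levi-Civita connection. *)
Definition christoffel (k i j : 'I_d) (x : 'rV[R]_d) : R :=
  2^-1 * \sum_l ginv x k l *
    (partial i (fun y => g y j l) x + partial j (fun y => g y i l) x
     - partial l (fun y => g y i j) x).

(* R^l_kij, where R(e_i, e_j) e_k = \sum_l R^l_kij e_l and
   R(X, Y) = [nabla_X, nabla_Y] - nabla_[X, Y]. *)
Definition riemann (l k i j : 'I_d) (x : 'rV[R]_d) : R :=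
  partial i (christoffel l j k) x - partial j (christoffel l i k) x
  + \sum_m (christoffel l i m x * christoffel m j k x
            - christoffel l j m x * christoffel m i k x).

Definition ricci (j k : 'I_d) (x : 'rV[R]_d) : R := \sum_i riemann i k i j x.

Definition scalar_curvature (x : 'rV[R]_d) : R :=
  \sum_j \sum_k ginv x j k * ricci j k x.

Definition gradient (f : 'rV[R]_d -> R) (i : 'I_d) (x : 'rV[R]_d) : R :=
  \sum_j ginv x i j * partial j f x.

(* The trace of the covariant derivative nabla X. *)
Definition divergence (X : 'I_d -> 'rV[R]_d -> R) (x : 'rV[R]_d) : R :=
  \sum_i (partial i (X i) x + \sum_j christoffel i i j x * X j x).

Definition laplacian (f : 'rV[R]_d -> R) (x : 'rV[R]_d) : R :=
  divergence (gradient f) x.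

End LocalRiemannian.

(* The norm `|u| of the library on 'rV[R]_m is the sup norm; Euclidean geometry
   goes through dot. *)
Definition dot (R : realType) (m : nat) (u v : 'rV[R]_m) : R :=
  (u *m v^T) 0 0.

(* The eigenvalues of a matrix whose characteristic polynomial splits over R,
   repeated according to multiplicity.  A shape operator is self-adjoint for
   the metric, so it is of this kind. *)
Definition eigenvalues (R : realType) (d : nat) (A : 'M[R]_d) : seq R :=
  xget [::] [set s | char_poly A = \prod_(a <- s) ('X - a%:P)].

(* Extrinsic geometry of a hypersurface of the unit sphere of R^m in local
   coordinates: f is the immersion and N the unit normal field.  A tangent
   vector is the row vector of its coordinates and linear maps act on the
   right, as in the library's 'J, whose i-th row is the i-th partial
   derivative. *)
Section LocalHypersurface.
Variables (R : realType) (d m : nat) (f N : 'rV[R]_d -> 'rV[R]_m).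

Definition induced_metric (x : 'rV[R]_d) : 'M[R]_d := 'J f x *m ('J f x)^T.

(* v |-> \bar\nabla_v N: the Levi-Civita connection of the sphere is the
   derivative in R^m followed by the orthogonal projection
   w |-> w - <w, f x> f x onto the tangent space of the sphere at f x. *)
Definition sphere_nabla (x : 'rV[R]_d) : 'M[R]_(d, m) :=
  'J N x *m (1%:M - (f x)^T *m f x).

(* The matrix A with A *m 'J f x = - sphere_nabla x, i.e. df (A v) is
   - \bar\nabla_v N; it is unique since f is an immersion. *)
Definition shape_operator (x : 'rV[R]_d) : 'M[R]_d :=
  - sphere_nabla x *m pinvmx ('J f x).

Definition shape_norm2 (x : 'rV[R]_d) : R :=
  \sum_(a <- eigenvalues (shape_operator x)) a ^+ 2.

End LocalHypersurface.

Section GlobalHypersurface.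
Variables (R : realType) (M : topologicalType) (d m : nat).
Variable At : oriented_atlas R M d.

Definition sphere_immersion (phi : M -> 'rV[R]_m) : Prop :=
  [/\ smooth_map At phi,
      forall p, dot (phi p) (phi p) = 1
    & forall i x, cod (At i) x -> row_free ('J (phi \o bwd (At i)) x)].

(* The three pointwise conditions: N has length 1, is tangent to the sphere,
   and is orthogonal to the image of d phi. *)
Definition unit_normal_field (phi N : M -> 'rV[R]_m) : Prop :=
  [/\ smooth_map At N,
      forall p, dot (N p) (N p) = 1,
      forall p, dot (N p) (phi p) = 0
    & forall i x, cod (At i) x ->
        'J (phi \o bwd (At i)) x *m (N (bwd (At i) x))^T = 0].

(* The metric, the shape operator, |A|^2, the scalar curvature and the
   Laplacian are read in the charts: conditions on them are required in every
   chart of the atlas, at every point of its image. *)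

Definition chart_metric (phi : M -> 'rV[R]_m) (i : index At) :=
  induced_metric (phi \o bwd (At i)).

Definition chart_shape (phi N : M -> 'rV[R]_m) (i : index At) :=
  shape_operator (phi \o bwd (At i)) (N \o bwd (At i)).

Definition chart_shape_norm2 (phi N : M -> 'rV[R]_m) (i : index At) :=
  shape_norm2 (phi \o bwd (At i)) (N \o bwd (At i)).

Definition minimal (phi N : M -> 'rV[R]_m) : Prop :=
  forall i x, cod (At i) x -> \tr (chart_shape phi N i x) = 0.

Definition constant_scalar_curvature (phi : M -> 'rV[R]_m) : Prop :=
  exists S : R, forall i x, cod (At i) x ->
    scalar_curvature (chart_metric phi i) x = S.

Definition laplace_eigenvalue (phi : M -> 'rV[R]_m) (lambda : R) : Prop :=
  exists h : M -> R,
    [/\ smooth_map At h,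
        exists p, h p != 0
      & forall i x, cod (At i) x ->
          laplacian (chart_metric phi i) (h \o bwd (At i)) x
          = - lambda * h (bwd (At i) x)].

End GlobalHypersurface.

(* Main.v *)
Require Import Defs.
From HB Require Import structures.
From mathcomp Require Import all_boot all_order all_algebra.
From mathcomp Require Import all_classical all_reals all_analysis.
From mathcomp Require Import ring lra.
Import Order.TTheory GRing.Theory Num.Theory.
Import numFieldNormedType.Exports.
Local Open Scope classical_set_scope.
Local Open Scope ring_scope.

Set Implicit Arguments.
Unset Strict Implicit.
Unset Printing Implicit Defensive.

(** Write f for the position vector of the hypersurface in R^(d+2), nu for its
    unit normal and h for its second fundamental form.  By the formulas of Gauss
    and Weingarten, minimality gives

      Lap f = - d f   and   Lap nu = - |A|^2 nu + (a tangential term),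

    and the tangential term is the divergence of h, which the Codazzi equation
    turns into the differential of the trace of h, that is, into 0.  So the
    coordinates f_a and nu_b are eigenfunctions for d and for |A|^2.  A single
    product f_a nu_b need not be an eigenfunction, because of the cross term
    2 <grad f_a, grad nu_b>; but A is self-adjoint, so this term is symmetric in
    a and b and drops out of f_a nu_b - f_b nu_a.  The Pluecker coordinates of
    the plane spanned by f and nu thus satisfy Lap u = - (d + |A|^2) u
    (laplacian_wedge).  They do not all vanish, since f and nu are linearly
    independent; hence d + |A|^2 is an eigenvalue, and it exceeds 12 when d = 6
    and |A|^2 > 6.

    That |A|^2 is constant follows from the Gauss equation, whose double trace
    says that the scalar curvature of a minimal hypersurface is
    d (d - 1) - |A|^2 (scalar_curvatureE).

    In a chart everything is expressed through the d x (d + 2) Jacobian F of f.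
    Three facts carry the computation: f, nu and the rows of F form a frame of
    R^(d+2) (hypersurface_frame); derivatives of the orthogonality relations of
    this frame vanish (dmx_mul_cst); and second derivatives are symmetric
    (derive_comm).  Sums over tensor indices become products and traces of
    matrices. *)

(** * Symmetry of second derivatives *)

Section Schwarz.
Variables (R : realType) (U : normedModType R).
Implicit Types (f : U -> R) (a v w : U).

Lemma is_derive_translate f a b v : derivable f (a + b) v ->
  is_derive a v (fun y => f (y + b)) ('D_v f (a + b)).
Proof.
have E : (fun h : R => h^-1 *:
      (((fun y => f (y + b)) \o shift a) (h *: v) - f (a + b)))
    = (fun h : R => h^-1 *: ((f \o shift (a + b)) (h *: v) - f (a + b))).
  by apply/funext => h /=; rewrite addrA.
by move=> df; split; rewrite /derivable /derive E.
Qed.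

Lemma is_derive_line f a v (s : R) : derivable f (s *: v + a) v ->
  is_derive s 1 (fun r => f (r *: v + a)) ('D_v f (s *: v + a)).
Proof.
have E : (fun h : R => h^-1 *:
      (((fun r => f (r *: v + a)) \o shift s) (h *: 1) - f (s *: v + a)))
    = (fun h : R => h^-1 *:
      ((f \o shift (s *: v + a)) (h *: v) - f (s *: v + a))).
  by apply/funext => h /=; rewrite [h *: 1]mulr1 scalerDl addrA.
by move=> df; split; rewrite /derivable /derive E.
Qed.

Lemma MVT_line f a v (e : R) : 0 < e ->
  (forall s, 0 <= s <= e -> derivable f (s *: v + a) v) ->
  exists2 s, 0 <= s <= e & f (e *: v + a) - f a = 'D_v f (s *: v + a) * e.
Proof.
move=> e0 df.
have /= [||s + E] := MVT (f := fun r => f (r *: v + a))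
    (df := fun s => 'D_v f (s *: v + a)) e0.
- move=> s; rewrite in_itv /= => /andP[s0 se].
  by apply: is_derive_line; apply: df; rewrite !ltW.
- apply: derivable_within_continuous => s; rewrite in_itv /= => /df/is_derive_line.
  by case.
- rewrite in_itv /= => /andP[s0 se]; exists s; first by rewrite !ltW.
  by move: E; rewrite scale0r add0r subr0.
Qed.

(** The mean value theorem is used twice: in the direction v for the increment
    of f in the direction w, then in the direction w for the derivative of f
    along v. *)
Lemma second_difference f a v w (e : R) : 0 < e ->
  (forall s t, 0 <= s <= e -> 0 <= t <= e ->
     derivable f (s *: v + (t *: w + a)) v /\
     derivable ('D_v f) (s *: v + (t *: w + a)) w) ->
  exists s t, [/\ 0 <= s <= e, 0 <= t <= e &
    f (e *: v + (e *: w + a)) - f (e *: v + a) - f (e *: w + a) + f a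
    = 'D_w ('D_v f) (s *: v + (t *: w + a)) * e * e].
Proof.
move=> e0 df.
have ee : 0 <= e <= e by rewrite (ltW e0) lexx.
have e00 : (0 : R) <= 0 <= e by rewrite lexx (ltW e0).
pose g y := f (y + e *: w) - f y.
have dg s : 0 <= s <= e -> is_derive (s *: v + a) v g
    ('D_v f (s *: v + (e *: w + a)) - 'D_v f (s *: v + a)).
  move=> se; apply: is_deriveB; last first.
    by apply: derivableP; have [] := df s 0 se e00; rewrite scale0r add0r.
  have := @is_derive_translate f (s *: v + a) (e *: w) v.
  rewrite -addrA (addrC a); apply.
  by have [dfse _] := df s e se ee; exact: dfse.
have [s se E1] := MVT_line (f := g) (a := a) (v := v) e0
  (fun s se => ex_derive (is_derive := dg s se)).
have [] := MVT_line (f := 'D_v f) (a := s *: v + a) (v := w) e0.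
  by move=> t te; have [_] := df s t se te; rewrite addrCA.
move=> t te E2; exists s, t; split => //.
rewrite (addrCA (s *: v)) -E2 (addrCA (e *: w)).
rewrite -(@derive_val _ _ _ _ _ _ _ (dg s se)) -E1 /g.
rewrite -(addrA (e *: v)) (addrC a) opprB -[LHS]addrA.
by congr (_ + _); rewrite addrC.
Qed.

(** The second difference of f over a small parallelogram is symmetric in v and
    w, and e^2 times either mixed derivative at some point of the parallelogram;
    continuity at a then forces the two mixed derivatives to agree. *)
Lemma derive_comm f a v w :
  (\forall y \near a, [/\ derivable f y v, derivable f y w,
     derivable ('D_v f) y w & derivable ('D_w f) y v]) ->
  {for a, continuous ('D_w ('D_v f))} -> {for a, continuous ('D_v ('D_w f))} ->
  'D_w ('D_v f) a = 'D_v ('D_w f) a.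
Proof.
move=> df cwv cvw; apply/eqP/negPn/negP => neq.
set A := 'D_w ('D_v f) a in neq *; set B := 'D_v ('D_w f) a in neq *.
pose d := `|A - B| / 2.
have d0 : 0 < d by rewrite divr_gt0 // normr_gt0 subr_eq0.
have Fwv : \forall y \near a, `|A - 'D_w ('D_v f) y| < d.
  by move/cvgrPdist_lt: cwv; apply.
have Fvw : \forall y \near a, `|B - 'D_v ('D_w f) y| < d.
  by move/cvgrPdist_lt: cvw; apply.
have F := filterI df (filterI Fwv Fvw).
have [r /= r0 sub] : nbhs_ball a _ := (nbhs_ballP _ _).1 (F _ _).
(* The added 1 keeps the denominator positive when v and w are 0. *)
pose e := r / (`|v| + `|w| + 1).
have n0 : 0 < `|v| + `|w| + 1 by rewrite ltr_pwDr // addr_ge0.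
have e0 : 0 < e by rewrite divr_gt0.
have inb s t : 0 <= s <= e -> 0 <= t <= e -> ball a r (s *: v + (t *: w + a)).
  move=> /andP[s0 se] /andP[t0 te]; rewrite -ball_normE /=.
  rewrite addrA opprD addrCA subrr addr0 normrN.
  apply: le_lt_trans (ler_normD _ _) _; rewrite !normrZ !ger0_norm //.
  apply: le_lt_trans (_ : e * (`|v| + `|w|) < r).
    by rewrite mulrDr lerD // ler_wpM2r.
  by rewrite /e mulrAC ltr_pdivrMr // ltr_pM2l // ltrDl.
have [s [t [se te E1]]] : exists s t, [/\ 0 <= s <= e, 0 <= t <= e &
    f (e *: v + (e *: w + a)) - f (e *: v + a) - f (e *: w + a) + f a
    = 'D_w ('D_v f) (s *: v + (t *: w + a)) * e * e].
  apply: (second_difference e0) => s t se te.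
  by have [[fv _ fvw _] _] := sub _ (inb s t se te); split; [exact: fv|exact: fvw].
have [t' [s' [te' se' E2]]] : exists t s, [/\ 0 <= t <= e, 0 <= s <= e &
    f (e *: w + (e *: v + a)) - f (e *: w + a) - f (e *: v + a) + f a
    = 'D_v ('D_w f) (t *: w + (s *: v + a)) * e * e].
  apply: (second_difference e0) => t' s' te' se'; rewrite (addrCA (t' *: w)).
  by have [[_ fw _ fwv] _] := sub _ (inb s' t' se' te'); split; [exact: fw|exact: fwv].
have sym : f (e *: v + (e *: w + a)) - f (e *: v + a) - f (e *: w + a) + f a
    = f (e *: w + (e *: v + a)) - f (e *: w + a) - f (e *: v + a) + f a.
  by rewrite (addrCA (e *: w)) (addrAC _ (- f (e *: v + a))).
have en0 : e != 0 by rewrite gt_eqF.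
have EE := mulIf en0 (mulIf en0 (etrans (etrans (esym E1) sym) E2)).
have [_ [+ _]] := sub _ (inb s t se te).
have [_ [_ +]] := sub _ (inb s' t' se' te').
rewrite (addrCA (s' *: v)) -EE.
move: ('D_w ('D_v f) _) => C h1 h2.
have : `|A - B| < d + d.
  by apply: le_lt_trans (ler_distD C A B) _; apply: ltrD h2 _; rewrite distrC.
by rewrite /d -splitr ltxx.
Qed.

End Schwarz.

(** * Smooth functions on an open set *)

Section Smooth.
Variables (R : realType) (d : nat) (V : set 'rV[R]_d).
Hypothesis V_open : open V.

Lemma near_open (P : 'rV[R]_d -> Prop) x :
  (forall y, V y -> P y) -> V x -> \forall y \near x, P y.
Proof.
by move=> VP Vx; near do apply: VP; exact: open_nbhs_nbhs.
Unshelve. all: by end_near. Qed.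

Section Congruence.
Variable W : normedModType R.
Implicit Types f g : 'rV[R]_d -> W.

(** Two functions that agree near x differ there by 0, so the linear part of f
    at x also approximates g to first order. *)
Lemma near_eq_differentiable f g x :
  (\forall y \near x, f y = g y) -> differentiable f x -> differentiable g x.
Proof.
move=> fg df.
have gx : g \o shift x = cst (g x) + 'd f x +o_ 0 id.
  apply/eqaddoP => e e0.
  have /eqaddoP/(_ e e0) := diff_locally df.
  have : \forall h \near 0, f (h + x) = g (h + x).
    by move: fg; rewrite (near_shift 0); apply: filterS => h /=; rewrite subr0.
  apply: filterS2 => h /= E.
  rewrite -[((f \o shift x) - (cst (f x) + 'd f x)) h]/(f (h + x) - (f x + 'd f x h)).
  rewrite -[((g \o shift x) - (cst (g x) + 'd f x)) h]/(g (h + x) - (g x + 'd f x h)).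
  by rewrite E (nbhs_singleton fg).
have dgf : 'd g x = 'd f x :> (_ -> _) by apply: diff_unique => //; exact: diff_continuous.
by apply/diff_locallyP; rewrite dgf; split => //; exact: diff_continuous.
Qed.

Lemma eq_derive f g x v : f =1 g -> 'D_v f x = 'D_v g x.
Proof. by move=> /funext ->. Qed.

Lemma eq_on_derive f g x v :
  (forall y, V y -> f y = g y) -> V x -> 'D_v f x = 'D_v g x.
Proof. by move=> fg Vx; apply: near_eq_derive; apply: (near_open fg). Qed.

(** The rules of differentiation give a derivative only at the points of V,
    whereas diffn differentiates total functions again and again; since V is
    open, the values off V do not matter, and the rules can be iterated. *)
Lemma eq_on_diffn k f g :
  (forall y, V y -> f y = g y) -> diffn k V f -> diffn k V g.
Proof.
elim: k f g => [|k IH] f g fg [df dfk]; split => //.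
- by move=> x Vx; apply: near_eq_differentiable (df x Vx); exact: near_open.
- by move=> x Vx; apply: near_eq_differentiable (df x Vx); exact: near_open.
- by move=> v; apply: IH (dfk v) => y Vy; exact: eq_on_derive.
Qed.

Lemma diffnS k f : diffn k.+1 V f -> diffn k V f.
Proof.
elim: k f => [|k IH] f [df dfk]; split => // v; apply: IH; exact: dfk.
Qed.

Lemma smooth_differentiable f x : smooth_on V f -> V x -> differentiable f x.
Proof. by move=> /(_ 0%N)[df _] /df. Qed.

Lemma smooth_derivable f x v : smooth_on V f -> V x -> derivable f x v.
Proof. by move=> sf Vx; apply/diff_derivable/smooth_differentiable. Qed.

Lemma smooth_derive f v : smooth_on V f -> smooth_on V ('D_v f).
Proof. by move=> sf k; have [_ /(_ v)] := sf k.+1. Qed.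

Lemma eq_on_smooth f g :
  (forall y, V y -> f y = g y) -> smooth_on V f -> smooth_on V g.
Proof. by move=> fg sf k; apply: eq_on_diffn (sf k). Qed.

End Congruence.

Implicit Types f g : 'rV[R]_d -> R.

Lemma diffn_cst k (c : R) : diffn k V (fun=> c).
Proof.
elim: k c => [|k IH] c; split => //.
  by move=> v; apply: (@eq_on_diffn _ _ (fun=> 0)) => // x Vx; rewrite derive_cst.
Qed.

Lemma diffnD k f g : diffn k V f -> diffn k V g -> diffn k V (fun x => f x + g x).
Proof.
elim: k f g => [|k IH] f g [df dfk] [dg dgk]; split => //.
- by move=> x Vx; apply: differentiableD; [exact: df|exact: dg].
- by move=> x Vx; apply: differentiableD; [exact: df|exact: dg].
move=> v; apply: (@eq_on_diffn _ _ (fun x => 'D_v f x + 'D_v g x)).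
  by move=> x Vx; rewrite deriveD//; apply: diff_derivable; [exact: df|exact: dg].
exact: IH (dfk v) (dgk v).
Qed.

Lemma diffnM k f g : diffn k V f -> diffn k V g -> diffn k V (fun x => f x * g x).
Proof.
elim: k f g => [|k IH] f g.
  move=> [df _] [dg _]; split => // x Vx.
  by apply: differentiableM; [exact: df|exact: dg].
move=> sf sg; have [df dfk] := sf; have [dg dgk] := sg; split.
  by move=> x Vx; apply: differentiableM; [exact: df|exact: dg].
move=> v; apply: (@eq_on_diffn _ _ (fun x => f x * 'D_v g x + g x * 'D_v f x)).
  by move=> x Vx; rewrite deriveM//; apply: diff_derivable; [exact: df|exact: dg].
by apply: diffnD; [apply: IH (diffnS sf) (dgk v)|apply: IH (diffnS sg) (dfk v)].
Qed.

Lemma diffnV k f : (forall x, V x -> f x != 0) -> diffn k V f ->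
  diffn k V (fun x => (f x)^-1).
Proof.
move=> f0; elim: k => [|k IH].
  by move=> [df _]; split => // x Vx; apply: differentiableV; [exact: df|exact: f0].
move=> sf; have [df dfk] := sf; split.
  by move=> x Vx; apply: differentiableV; [exact: df|exact: f0].
move=> v; apply: (@eq_on_diffn _ _ (fun x => (-1 * ((f x)^-1 * (f x)^-1)) * 'D_v f x)).
  move=> x Vx; rewrite deriveV ?f0//; last by apply: diff_derivable; exact: df.
  by rewrite mulN1r -exprVn expr2.
have sfV := IH (diffnS sf).
by apply: diffnM (dfk v); apply: diffnM; [exact: diffn_cst|exact: diffnM].
Qed.

Lemma smooth_cst (c : R) : smooth_on V (fun=> c).
Proof. by move=> k; exact: diffn_cst. Qed.

Lemma smoothD f g : smooth_on V f -> smooth_on V g -> smooth_on V (fun x => f x + g x).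
Proof. by move=> sf sg k; exact: diffnD. Qed.

Lemma smoothM f g : smooth_on V f -> smooth_on V g -> smooth_on V (fun x => f x * g x).
Proof. by move=> sf sg k; exact: diffnM. Qed.

Lemma smoothV f : (forall x, V x -> f x != 0) -> smooth_on V f ->
  smooth_on V (fun x => (f x)^-1).
Proof. by move=> f0 sf k; exact: diffnV. Qed.

Lemma smooth_sum (I : Type) (r : seq I) (P : pred I) (F : I -> 'rV[R]_d -> R) :
  (forall i, smooth_on V (F i)) -> smooth_on V (fun x => \sum_(i <- r | P i) F i x).
Proof.
move=> sF; elim: r => [|i r IH].
  by under eq_fun do rewrite big_nil; exact: smooth_cst.
under eq_fun do rewrite big_cons.
by case: (P i) => //; exact: smoothD.
Qed.

Lemma smooth_prod (I : Type) (r : seq I) (P : pred I) (F : I -> 'rV[R]_d -> R) :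
  (forall i, smooth_on V (F i)) -> smooth_on V (fun x => \prod_(i <- r | P i) F i x).
Proof.
move=> sF; elim: r => [|i r IH].
  by under eq_fun do rewrite big_nil; exact: smooth_cst.
under eq_fun do rewrite big_cons.
by case: (P i) => //; exact: smoothM.
Qed.

Lemma derive_coord m (f : 'rV[R]_d -> 'rV[R]_m) p x v : differentiable f x ->
  'D_v (fun y => f y 0 p) x = 'D_v f x 0 p.
Proof. by move=> df; rewrite derive_mx ?mxE //; exact: diff_derivable. Qed.

Lemma smooth_coord m (f : 'rV[R]_d -> 'rV[R]_m) p :
  smooth_on V f -> smooth_on V (fun y => f y 0 p).
Proof.
move=> sf k; move: f sf; elim: k => [|k IH] f sf.
  split=> // x Vx.
  apply: (@differentiable_comp _ _ _ _ f (fun N : 'rV[R]_m => N 0 p : R)).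
    exact: smooth_differentiable.
  exact: differentiable_coord.
split.
  move=> x Vx.
  apply: (@differentiable_comp _ _ _ _ f (fun N : 'rV[R]_m => N 0 p : R)).
    exact: smooth_differentiable.
  exact: differentiable_coord.
move=> v; apply: (@eq_on_diffn _ _ (fun x => 'D_v f x 0 p)).
  by move=> x Vx; rewrite derive_coord //; exact: smooth_differentiable.
by apply: IH; exact: smooth_derive.
Qed.

Lemma smooth_derive_comm f x v w : smooth_on V f -> V x ->
  'D_w ('D_v f) x = 'D_v ('D_w f) x.
Proof.
move=> sf Vx; apply: derive_comm.
- apply: near_open Vx => y Vy.
  by split; apply: smooth_derivable Vy => //; exact: smooth_derive.
- apply: differentiable_continuous; apply: smooth_differentiable Vx.
  by do 2 apply: smooth_derive.
- apply: differentiable_continuous; apply: smooth_differentiable Vx.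
  by do 2 apply: smooth_derive.
Qed.

End Smooth.

(** * Entrywise derivatives of matrix-valued functions *)

(** Locked, so that derivatives of two different functions are never compared by
    unfolding both to limits. *)
HB.lock Definition dmx (R : realType) d m n (i : 'I_d)
    (X : 'rV[R]_d -> 'M[R]_(m, n)) (x : 'rV[R]_d) : 'M[R]_(m, n) :=
  \matrix_(a, b) partial i (fun y => X y a b) x.

Lemma dmxE (R : realType) d m n (i : 'I_d) (X : 'rV[R]_d -> 'M[R]_(m, n)) x a b :
  dmx i X x a b = partial i (fun y => X y a b) x.
Proof. by rewrite dmx.unlock mxE. Qed.

Section MatrixCalculus.
Variables (R : realType) (d : nat) (V : set 'rV[R]_d).
Hypothesis V_open : open V.

(** Entrywise, so that matrix products and inverses reduce to sums, products and
    inverses of scalar functions. *)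
Definition smooth_mx m n (X : 'rV[R]_d -> 'M[R]_(m, n)) : Prop :=
  forall a b, smooth_on V (fun y => X y a b).

Lemma eq_dmx m n (i : 'I_d) (X Y : 'rV[R]_d -> 'M[R]_(m, n)) x :
  (forall y, V y -> X y = Y y) -> V x -> dmx i X x = dmx i Y x.
Proof.
move=> XY Vx; apply/matrixP => a b; rewrite !dmxE.
by apply: (eq_on_derive V_open _ _ Vx) => y /XY ->.
Qed.

Lemma eq_smooth_mx m n (X Y : 'rV[R]_d -> 'M[R]_(m, n)) :
  (forall y, V y -> X y = Y y) -> smooth_mx X -> smooth_mx Y.
Proof.
by move=> XY sX a b; apply: (eq_on_smooth V_open _ (sX a b)) => y /XY ->.
Qed.

Lemma smooth_dmx m n (i : 'I_d) (X : 'rV[R]_d -> 'M[R]_(m, n)) :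
  smooth_mx X -> smooth_mx (dmx i X).
Proof.
move=> sX a b; apply: (eq_on_smooth V_open _ (smooth_derive (delta_mx 0 i) (sX a b))).
by move=> y _; rewrite dmxE.
Qed.

Lemma smooth_cst_mx m n (C : 'M[R]_(m, n)) : smooth_mx (fun=> C).
Proof. by move=> a b; exact: smooth_cst. Qed.

Lemma smooth_trmx m n (X : 'rV[R]_d -> 'M[R]_(m, n)) :
  smooth_mx X -> smooth_mx (fun y => (X y)^T).
Proof. by move=> sX a b; apply: (eq_on_smooth V_open _ (sX b a)) => y _; rewrite mxE. Qed.

Lemma smooth_addmx m n (X Y : 'rV[R]_d -> 'M[R]_(m, n)) :
  smooth_mx X -> smooth_mx Y -> smooth_mx (fun y => X y + Y y).
Proof.
move=> sX sY a b.
by apply: (eq_on_smooth V_open _ (smoothD V_open (sX a b) (sY a b))) => y _; rewrite mxE.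
Qed.

Lemma smooth_mulmx m n p (X : 'rV[R]_d -> 'M[R]_(m, n))
    (Y : 'rV[R]_d -> 'M[R]_(n, p)) :
  smooth_mx X -> smooth_mx Y -> smooth_mx (fun y => X y *m Y y).
Proof.
move=> sX sY a b.
have sXY : smooth_on V (fun y => \sum_c X y a c * Y y c b).
  by apply: smooth_sum => // c; exact: smoothM.
by apply: (eq_on_smooth V_open _ sXY) => y _; rewrite mxE.
Qed.

Lemma smooth_oppmx m n (X : 'rV[R]_d -> 'M[R]_(m, n)) :
  smooth_mx X -> smooth_mx (fun y => - X y).
Proof.
move=> sX a b; have s1 := smoothM V_open (smooth_cst V_open (-1)) (sX a b).
by apply: (eq_on_smooth V_open _ s1) => y _; rewrite mxE mulN1r.
Qed.

Lemma smooth_det n (X : 'rV[R]_d -> 'M[R]_n) :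
  smooth_mx X -> smooth_on V (fun y => \det (X y)).
Proof.
move=> sX; apply: smooth_sum => // s; apply: smoothM => //; first exact: smooth_cst.
by apply: smooth_prod => // i; exact: sX.
Qed.

(** By Cramer's rule the entries are cofactors divided by the determinant. *)
Lemma smooth_invmx n (X : 'rV[R]_d -> 'M[R]_n) :
  (forall y, V y -> X y \in unitmx) -> smooth_mx X ->
  smooth_mx (fun y => invmx (X y)).
Proof.
move=> uX sX a b.
have sadj : smooth_on V (fun y => (\det (X y))^-1 *
    ((-1) ^+ (b + a) * \det (row' b (col' a (X y))))).
  apply: smoothM => //.
    apply: smoothV => //; last exact: smooth_det.
    by move=> y /uX; rewrite unitmxE unitfE.
  apply: smoothM => //; first exact: smooth_cst.
  apply: smooth_det => i j; apply: (eq_on_smooth V_open _ (sX (lift b i) (lift a j))) => y _.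
  by rewrite !mxE.
apply: (eq_on_smooth V_open _ sadj) => y Vy.
by rewrite /invmx uX // !mxE.
Qed.

Lemma dmx_cst m n (i : 'I_d) (C : 'M[R]_(m, n)) x : dmx i (fun=> C) x = 0.
Proof. by apply/matrixP => a b; rewrite dmxE mxE; exact: derive_cst. Qed.

Lemma dmx_tr m n (i : 'I_d) (X : 'rV[R]_d -> 'M[R]_(m, n)) x :
  dmx i (fun y => (X y)^T) x = (dmx i X x)^T.
Proof.
by apply/matrixP => a b; rewrite [RHS]mxE !dmxE; apply: eq_derive => y; rewrite mxE.
Qed.

Lemma smooth_mx_derivable m n (X : 'rV[R]_d -> 'M[R]_(m, n)) a b x v :
  smooth_mx X -> V x -> derivable (fun y => X y a b) x v.
Proof. by move=> sX Vx; apply: smooth_derivable (sX a b) Vx. Qed.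

Lemma dmxD m n (i : 'I_d) (X Y : 'rV[R]_d -> 'M[R]_(m, n)) x :
  smooth_mx X -> smooth_mx Y -> V x ->
  dmx i (fun y => X y + Y y) x = dmx i X x + dmx i Y x.
Proof.
move=> sX sY Vx; apply/matrixP => a b; rewrite [RHS]mxE !dmxE /partial.
rewrite -deriveD; [|exact: smooth_mx_derivable..].
by apply: eq_derive => y; rewrite mxE.
Qed.

Lemma dmxN m n (i : 'I_d) (X : 'rV[R]_d -> 'M[R]_(m, n)) x :
  smooth_mx X -> V x -> dmx i (fun y => - X y) x = - dmx i X x.
Proof.
move=> sX Vx; apply/matrixP => a b; rewrite [RHS]mxE !dmxE /partial.
rewrite -deriveN; [|exact: smooth_mx_derivable..].
by apply: eq_derive => y; rewrite mxE.
Qed.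

Lemma dmxM m n p (i : 'I_d) (X : 'rV[R]_d -> 'M[R]_(m, n))
    (Y : 'rV[R]_d -> 'M[R]_(n, p)) x :
  smooth_mx X -> smooth_mx Y -> V x ->
  dmx i (fun y => X y *m Y y) x = dmx i X x *m Y x + X x *m dmx i Y x.
Proof.
move=> sX sY Vx; apply/matrixP => a b; rewrite [RHS]mxE 2![in RHS]mxE.
rewrite dmxE /partial -big_split /=.
have -> : (fun y => (X y *m Y y) a b) = \sum_c (fun y => X y a c) * (fun y => Y y c b).
  by apply/funext => y; rewrite mxE fct_sumE.
rewrite derive_sum; last by move=> c; apply: derivableM; exact: smooth_mx_derivable.
apply: eq_bigr => c _; rewrite deriveM; [|exact: smooth_mx_derivable..].
by rewrite !dmxE addrC; congr (_ + _); rewrite [LHS]mulrC.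
Qed.

Lemma dmxMr m n p (i : 'I_d) (X : 'rV[R]_d -> 'M[R]_(m, n)) (C : 'M[R]_(n, p)) x :
  smooth_mx X -> V x -> dmx i (fun y => X y *m C) x = dmx i X x *m C.
Proof.
by move=> sX Vx; rewrite (dmxM i sX (smooth_cst_mx C) Vx) dmx_cst mulmx0 addr0.
Qed.

(** Differentiating a constraint; the orthogonality relations of the frame yield
    the structure equations through this lemma. *)
Lemma dmx_mul_cst m n p (i : 'I_d) (X : 'rV[R]_d -> 'M[R]_(m, n))
    (Y : 'rV[R]_d -> 'M[R]_(n, p)) C x :
  smooth_mx X -> smooth_mx Y -> (forall y, V y -> X y *m Y y = C) -> V x ->
  dmx i X x *m Y x = - (X x *m dmx i Y x).
Proof.
move=> sX sY XY Vx; apply/eqP; rewrite -addr_eq0 -(dmxM i sX sY Vx).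
by rewrite (eq_dmx i (Y := fun=> C) XY Vx) dmx_cst.
Qed.

(** Differentiate X^-1 X = 1. *)
Lemma dmx_invmx n (i : 'I_d) (X : 'rV[R]_d -> 'M[R]_n) x :
  (forall y, V y -> X y \in unitmx) -> smooth_mx X -> V x ->
  dmx i (fun y => invmx (X y)) x = - (invmx (X x) *m dmx i X x *m invmx (X x)).
Proof.
move=> uX sX Vx; have sV := smooth_invmx uX sX.
have := dmxM i sV sX Vx.
rewrite (@eq_dmx _ _ _ _ (fun=> 1%:M)) //; last by move=> y Vy; rewrite mulVmx // uX.
rewrite dmx_cst => /eqP; rewrite eq_sym addr_eq0 => /eqP E.
by rewrite -mulNmx -E mulmxK // uX.
Qed.

Lemma dmx_comm m n (i j : 'I_d) (X : 'rV[R]_d -> 'M[R]_(m, n)) x :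
  smooth_mx X -> V x -> dmx i (dmx j X) x = dmx j (dmx i X) x.
Proof.
move=> sX Vx; apply/matrixP => a b; rewrite !dmxE.
transitivity ('D_(delta_mx 0 i) ('D_(delta_mx 0 j) (fun y => X y a b)) x).
  by apply: (eq_on_derive V_open _ _ Vx) => y _; rewrite dmxE.
rewrite (smooth_derive_comm V_open) //.
by apply: (eq_on_derive V_open _ _ Vx) => y _; rewrite dmxE.
Qed.

Lemma dmx_trace n (i : 'I_d) (X : 'rV[R]_d -> 'M[R]_n) x :
  smooth_mx X -> V x -> \tr (dmx i X x) = partial i (fun y => \tr (X y)) x.
Proof.
move=> sX Vx; rewrite /partial /mxtrace.
have -> : (fun y => \sum_a X y a a) = \sum_a (fun y => X y a a).
  by apply/funext => y; rewrite fct_sumE.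
rewrite derive_sum; last by move=> c; exact: smooth_mx_derivable.
by apply: eq_bigr => a _; rewrite dmxE.
Qed.

(** When the rows of U are the partial derivatives of u, both sides are the
    second derivative of u in the directions i and j. *)
Lemma dmx_rowC n (i j : 'I_d) (u : 'rV[R]_d -> 'rV[R]_n)
    (U : 'rV[R]_d -> 'M[R]_(d, n)) x :
  smooth_mx u -> (forall k y, V y -> row k (U y) = dmx k u y) -> V x ->
  row j (dmx i U x) = row i (dmx j U x).
Proof.
move=> su Uu Vx; have E k l : row l (dmx k U x) = dmx k (dmx l u) x.
  apply/rowP => p; rewrite [LHS]mxE !dmxE.
  by apply: (eq_on_derive V_open _ _ Vx) => y Vy; rewrite -Uu // mxE.
by rewrite !E dmx_comm.
Qed.

Section Jacobian.
Variables (m : nat) (f : 'rV[R]_d -> 'rV[R]_m).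
Hypothesis sf : smooth_on V f.

Lemma smooth_rv : smooth_mx f.
Proof. by move=> a b; rewrite ord1; exact: smooth_coord. Qed.

Lemma row_jacobian (i : 'I_d) x : V x -> row i ('J f x) = dmx i f x.
Proof.
move=> Vx; have df := smooth_differentiable sf Vx.
by apply/rowP => p; rewrite rowE -deriveEjacobian // dmxE /partial derive_coord.
Qed.

Lemma jacobianE (i : 'I_d) p x : V x -> 'J f x i p = dmx i f x 0 p.
Proof. by move=> Vx; rewrite -row_jacobian // [RHS]mxE. Qed.

Lemma smooth_jacobian : smooth_mx (fun y => 'J f y).
Proof.
move=> i p; apply: (eq_on_smooth V_open _ (smooth_dmx i smooth_rv 0 p)) => y Vy.
by rewrite jacobianE.
Qed.

End Jacobian.
End MatrixCalculus.

(** * Linear algebra of frames, traces and eigenvalues *)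

Lemma trmx11 (T : Type) (X : 'M[T]_1) : X^T = X.
Proof. by apply/matrixP => a b; rewrite !ord1 mxE. Qed.

Lemma col_mulmx (R : pzSemiRingType) m n p (X : 'M[R]_(m, n)) (Y : 'M[R]_(n, p)) i :
  X *m col i Y = col i (X *m Y).
Proof. by rewrite !colE mulmxA. Qed.

Lemma row_mulNB (R : pzRingType) m n p q (X : 'M[R]_(m, n)) (Y : 'M[R]_(n, p))
    (Z : 'M[R]_(m, q)) (W : 'M[R]_(q, p)) i :
  row i (- (X *m Y) - Z *m W) = - (row i X *m Y) - row i Z *m W.
Proof. by rewrite raddfB raddfN /= !row_mul. Qed.

(** In geometric terms G is an inverse metric, C holds the Christoffel symbols in
    the direction of a coordinate field and D is the derivative of h, so that
    - G C - (G C)^T is the derivative of G: the trace of a covariant derivative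
    is the derivative of the trace. *)
Lemma mxtrace_covariant (R : comPzRingType) n (G C h D : 'M[R]_n) : G^T = G ->
  \tr (G *m (D - h *m C^T - C *m h))
  = \tr ((- (G *m C) - (G *m C)^T) *m h + G *m D).
Proof.
move=> symG; rewrite trmx_mul symG !mulmxBr mulmxBl mulNmx !raddfD !raddfN /=.
rewrite -(mulmxA C^T) [\tr (C^T *m _)]mxtrace_mulC !mulmxA.
by rewrite addrC addrA addrAC addrC !addrA [X in X + _]addrC.
Qed.

Lemma eqN_mx0 (R : numDomainType) m n (X : 'M[R]_(m, n)) : X = - X -> X = 0.
Proof.
move=> XN; apply/matrixP => a b; rewrite mxE.
have /eqP := congr1 (fun M : 'M[R]_(m, n) => M a b) XN.
by rewrite mxE -addr_eq0 -mulr2n mulrn_eq0 /= => /eqP.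
Qed.

Section Algebra.
Variable F : fieldType.

(** The rows of B, u and v form a square matrix with right inverse
    [B^T G, u^T, v^T], which is then also a left inverse. *)
Lemma frame_decomposition d (B : 'M[F]_(d, d + 2)) (G : 'M[F]_d)
    (u v : 'rV[F]_(d + 2)) :
  B *m B^T *m G = 1%:M -> u *m u^T = 1%:M -> v *m v^T = 1%:M ->
  v *m u^T = 0 -> B *m u^T = 0 -> B *m v^T = 0 ->
  B^T *m G *m B + u^T *m u + v^T *m v = 1%:M.
Proof.
move=> BG uu vv vu Bu Bv.
have uv : u *m v^T = 0 by rewrite -[LHS]trmxK trmx_mul trmxK vu trmx0.
have uB : u *m B^T = 0 by rewrite -[LHS]trmxK trmx_mul trmxK Bu trmx0.
have vB : v *m B^T = 0 by rewrite -[LHS]trmxK trmx_mul trmxK Bv trmx0.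
pose P : 'M[F]_(d + (1 + 1), d + 2) := col_mx B (col_mx u v).
pose Q : 'M[F]_(d + 2, d + (1 + 1)) := row_mx (B^T *m G) (row_mx u^T v^T).
have PQ : P *m Q = 1%:M.
  rewrite /P /Q mul_col_row [X in block_mx _ _ _ X]mul_col_row.
  rewrite mul_mx_row mul_col_mx !mulmxA BG uB vB !mul0mx.
  rewrite Bu Bv uu vv uv vu row_mx0 col_mx0.
  by rewrite -!scalar_mx_block.
have QP : Q *m P = 1%:M := @mulmx1C _ (d + 2) P Q PQ.
by rewrite -QP /P /Q !mul_row_col addrA.
Qed.

Lemma mul_row_colE n (X Y : 'M[F]_n) i j : (row i X *m col j Y) = ((X *m Y) i j)%:M.
Proof.
apply/matrixP => a b; rewrite !ord1 !mxE /=.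
by apply: eq_bigr => k _; rewrite !mxE.
Qed.

Lemma mul_col_rowE n (X Y : 'M[F]_n) i j k l :
  (col i X *m row j Y) k l = X k i * Y j l.
Proof. by rewrite mxE big_ord1 !mxE. Qed.

Lemma sum_row_col n (X Y : 'M[F]_n) :
  \sum_i row i (X *m col i Y) = (\tr (X *m Y))%:M.
Proof.
rewrite /mxtrace raddf_sum; apply: eq_bigr => i _.
by rewrite row_mul mul_row_colE.
Qed.

Lemma sum_row_mul_col n p (X Y : 'M[F]_n) (w : 'rV[F]_p) :
  \sum_i row i (X *m (col i Y *m w)) = \tr (X *m Y) *: w.
Proof.
rewrite -mul_scalar_mx -sum_row_col mulmx_suml; apply: eq_bigr => i _.
by rewrite mulmxA row_mul.
Qed.

Lemma mxtrace_sym_skew n (X Y : 'M[F]_n) : 2%:R != 0 :> F ->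
  X^T = X -> Y^T = - Y -> \tr (X *m Y) = 0.
Proof.
move=> two symX skewY; have := mxtrace_tr (X *m Y).
rewrite trmx_mul symX skewY mulNmx raddfN mxtrace_mulC => /eqP.
rewrite eq_sym -addr_eq0 -mulr2n -mulr_natl mulf_eq0 (negPf two) /=.
by move=> /eqP.
Qed.

(** C i is the i-th slice of a totally symmetric tensor with three indices, so all
    its contractions with G coincide; applied to the covariant derivative of the
    second fundamental form, its divergence is the differential of its trace. *)
Lemma partial_trace_sym3 n (G : 'M[F]_n) (C : 'I_n -> 'M[F]_n) :
  (forall i, (C i)^T = C i) -> (forall i j, row j (C i) = row i (C j)) ->
  \sum_i row i (G *m C i) = \row_k \tr (G *m C k).
Proof.
move=> symC rowC; apply/rowP => k; rewrite summxE mxE.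
apply: eq_bigr => i _; rewrite !mxE; apply: eq_bigr => j _.
congr (_ * _).
have cs a b c : C a b c = C a c b by rewrite -[in RHS]symC mxE.
have cr a b c : C a b c = C b a c by have /rowP/(_ c) := rowC a b; rewrite !mxE.
by rewrite cs cr cs.
Qed.

(** The product rule for a covariant second derivative of X S y - Y S x, where X
    and Y are themselves the first derivatives of x^T and y^T: the second
    derivatives of each factor are separated from the cross terms. *)
Lemma tension_split n m (G C : 'M[F]_n) (DX DY X Y : 'M[F]_(n, m)) (S : 'M[F]_m)
    (x y x' y' : 'cV[F]_m) :
  G *m (DX *m S *m y + X *m S *m y' - (DY *m S *m x + Y *m S *m x')
    - C *m (X *m S *m y - Y *m S *m x))
  = G *m (DX - C *m X) *m (S *m y) - G *m (DY - C *m Y) *m (S *m x)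
    + (G *m (X *m S *m y') - G *m (Y *m S *m x')).
Proof.
rewrite !(opprD, opprK, mulmxDr, mulmxDl, mulmxN, mulNmx, mulmxA).
by rewrite [RHS](AC (2*2*2) (1*5*(3*6)*(2*4))).
Qed.

Lemma row_mulB n p q r (X : 'M[F]_(n, p)) (Y : 'M[F]_(p, r)) (Z : 'M[F]_(n, q))
    (W : 'M[F]_(q, r)) (P Q : 'M[F]_(n, r)) i :
  row i (X *m Y - Z *m W + (P - Q))
  = row i X *m Y - row i Z *m W + (row i P - row i Q).
Proof. by rewrite !linearD !linearN /= !row_mul. Qed.

End Algebra.

(** If v B B^T = 0 then v B has norm 0. *)
Lemma gram_unit (R : realType) m n (B : 'M[R]_(m, n)) :
  row_free B -> B *m B^T \in unitmx.
Proof.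
move=> fB; rewrite -row_free_unit -kermx_eq0; apply/eqP/row_matrixP => i.
rewrite row0; set v := row i _.
have vg : v *m (B *m B^T) = 0 by apply/sub_kermxP; exact: row_sub.
have vB : v *m B = 0.
  apply/rowP => k; rewrite [RHS]mxE.
  have : \sum_j (v *m B) 0 j ^+ 2 = 0.
    have := congr1 (fun M : 'rV[R]_m => (M *m v^T) 0 0) vg.
    rewrite /= mul0mx [RHS]mxE => E; rewrite -[RHS]E !mulmxA -(mulmxA (v *m B)) -trmx_mul mxE.
    by apply: eq_bigr => j _; rewrite [(_^T) _ _]mxE expr2.
  move/eqP; rewrite psumr_eq0 => [/allP/(_ k (mem_index_enum _))|j _]; last exact: sqr_ge0.
  by rewrite sqrf_eq0 => /eqP.
by apply: (row_free_inj fB); rewrite vB mul0mx.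
Qed.

Section Eigenvalues.
Variable F : idomainType.

Lemma comp_polyXn_inj n : (0 < n)%N -> injective (comp_poly ('X^n : {poly F})).
Proof.
move=> n0 p q /polyP pq; apply/polyP => k.
by have := pq (k * n)%N; rewrite !coef_comp_poly_Xn // dvdn_mull // mulnK.
Qed.

Lemma char_polyN n (A : 'M[F]_n) :
  char_poly (- A) = (-1) ^+ n * (char_poly A \Po - 'X).
Proof.
rewrite /char_poly -det_map_mx -detZ; congr (\det _).
apply/matrixP => i j; rewrite !mxE rmorphB /= comp_polyC rmorphMn /= comp_polyX.
by rewrite mulN1r opprB polyCN opprK mulNrn opprK addrC.
Qed.

(** This is det (X^2 - A^2) = det (X - A) det (X + A). *)
Lemma char_poly_sqr n (A : 'M[F]_n) :
  char_poly (A *m A) \Po 'X^2 = char_poly A * char_poly (- A).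
Proof.
rewrite /char_poly -det_map_mx -det_mulmx; congr (\det _).
have -> : map_mx (comp_poly 'X^2) (char_poly_mx (A *m A))
    = ('X^2)%:M - map_mx polyC A *m map_mx polyC A.
  rewrite -map_mxM; apply/matrixP => i j.
  by rewrite !mxE rmorphB /= comp_polyC rmorphMn /= comp_polyX.
rewrite /char_poly_mx map_mxN opprK mulmxBl !mulmxDr -scalar_mxM -expr2.
by rewrite (scalar_mxC 'X) addrKA.
Qed.

(** By char_poly_sqr the roots of the characteristic polynomial of A^2 are the
    squares of those of A, and minus the trace is the coefficient below the
    leading one. *)
Lemma mxtrace_sqr_roots n (A : 'M[F]_n) s :
  char_poly A = \prod_(a <- s) ('X - a%:P) ->
  \tr (A *m A) = \sum_(a <- s) a ^+ 2.
Proof.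
move=> As; have sz : size s = n.
  by apply: succn_inj; rewrite -(size_char_poly A) As size_prod_XsubC.
have mirror (t : seq F) : (-1) ^+ size t * (\prod_(a <- t) ('X - a%:P) \Po - 'X)
    = \prod_(a <- t) ('X + a%:P).
  elim: t => [|a t IH]; first by rewrite !big_nil rmorph1 mulr1.
  rewrite !big_cons exprS rmorphM /= mulrACA IH; congr (_ * _).
  by rewrite rmorphB /= comp_polyX comp_polyC mulN1r opprB opprK addrC.
have AAs : char_poly (A *m A) = \prod_(b <- [seq a ^+ 2 | a <- s]) ('X - b%:P).
  apply: (@comp_polyXn_inj 2) => //.
  rewrite char_poly_sqr char_polyN As -sz mirror big_map rmorph_prod /= -big_split /=.
  apply: eq_bigr => a _.
  by rewrite rmorphB /= comp_polyX comp_polyC polyC_exp subr_sqr.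
have [n0|n_gt0] := posnP n.
  have s0 : s = [::] by apply: size0nil; rewrite sz.
  by rewrite s0 big_nil /mxtrace big1 // => i _; move: (ltn_ord i); rewrite [X in (_ < X)%N]n0.
apply: oppr_inj; rewrite -char_poly_trace // AAs.
have nz : size [seq a ^+ 2 | a <- s] != 0%N by rewrite size_map sz -lt0n.
by have := coefPn_prod_XsubC nz; rewrite size_map sz => ->; rewrite big_map.
Qed.

End Eigenvalues.

(** A positive sum excludes the empty list, which is the default value when the
    characteristic polynomial does not split. *)
Lemma shape_norm2E (R : realType) d m (f N : 'rV[R]_d -> 'rV[R]_m) x :
  0 < shape_norm2 f N x ->
  shape_norm2 f N x = \tr (shape_operator f N x *m shape_operator f N x).
Proof.
rewrite /shape_norm2 /eigenvalues; case: xgetP => [s _ /mxtrace_sqr_roots -> //|_].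
by rewrite big_nil ltxx.
Qed.

(** * Structure equations of a hypersurface of the sphere *)

Section LocalHypersurface.
Variables (R : realType) (d : nat) (V : set 'rV[R]_d).
Variables (f nu : 'rV[R]_d -> 'rV[R]_(d + 2)).
(* F and Nu are the Jacobians of f and nu, and g is the metric induced by f.
   They are kept as variables because only the relations below matter. *)
Variables (F Nu : 'rV[R]_d -> 'M[R]_(d, d + 2)) (g : 'rV[R]_d -> 'M[R]_d).
Hypothesis V_open : open V.
Hypotheses (sf : smooth_mx V f) (snu : smooth_mx V nu).
Hypotheses (sF : smooth_mx V F) (sNu : smooth_mx V Nu).
Hypothesis row_F : forall i x, V x -> row i (F x) = dmx i f x.
Hypothesis row_Nu : forall i x, V x -> row i (Nu x) = dmx i nu x.
Hypothesis gE : forall x, g x = F x *m (F x)^T.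
Hypothesis f_unit : forall x, V x -> f x *m (f x)^T = 1%:M.
Hypothesis nu_unit : forall x, V x -> nu x *m (nu x)^T = 1%:M.
Hypothesis nu_f : forall x, V x -> nu x *m (f x)^T = 0.
Hypothesis f_immersed : forall x, V x -> row_free (F x).
Hypothesis nu_normal : forall x, V x -> F x *m (nu x)^T = 0.

Local Notation G := (ginv g).

Let sFT : smooth_mx V (fun y => (F y)^T) := smooth_trmx V_open sF.
Let sfT : smooth_mx V (fun y => (f y)^T) := smooth_trmx V_open sf.
Let snuT : smooth_mx V (fun y => (nu y)^T) := smooth_trmx V_open snu.
Let sg : smooth_mx V g.
Proof.
by apply: (eq_smooth_mx V_open _ (smooth_mulmx V_open sF sFT)) => y _; rewrite gE.
Qed.
Let g_unit y : V y -> g y \in unitmx.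
Proof. by move=> Vy; rewrite gE; apply: gram_unit; exact: f_immersed. Qed.
Let sG : smooth_mx V G := smooth_invmx V_open g_unit sg.

Lemma row_F_tr i x : V x -> (dmx i f x)^T = col i (F x)^T.
Proof. by move=> Vx; rewrite -row_F // tr_row. Qed.

Lemma row_Nu_tr i x : V x -> (dmx i nu x)^T = col i (Nu x)^T.
Proof. by move=> Vx; rewrite -row_Nu // tr_row. Qed.

(** The derivative of the constant inner product of u and w. *)
Lemma jacobian_dot (u w : 'rV[R]_d -> 'rV[R]_(d + 2))
    (U W : 'rV[R]_d -> 'M[R]_(d, d + 2)) C x :
  smooth_mx V u -> smooth_mx V w ->
  (forall i y, V y -> row i (U y) = dmx i u y) ->
  (forall i y, V y -> row i (W y) = dmx i w y) ->
  (forall y, V y -> u y *m (w y)^T = C) -> V x ->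
  U x *m (w x)^T = - (W x *m (u x)^T).
Proof.
move=> su sw Uu Ww uw Vx; apply/row_matrixP => i.
rewrite row_mul Uu // (dmx_mul_cst V_open i su (smooth_trmx V_open sw) uw Vx).
rewrite dmx_tr -Ww // [RHS]raddfN /= row_mul; congr (- _).
by rewrite -[LHS]trmx11 trmx_mul trmxK.
Qed.

Lemma jacobian_position x : V x -> F x *m (f x)^T = 0.
Proof. by move=> Vx; apply: eqN_mx0; exact: (jacobian_dot sf sf row_F row_F f_unit). Qed.

Lemma jacobian_normal_normal x : V x -> Nu x *m (nu x)^T = 0.
Proof. by move=> Vx; apply: eqN_mx0; exact: (jacobian_dot snu snu row_Nu row_Nu nu_unit). Qed.

Lemma jacobian_normal_position x : V x -> Nu x *m (f x)^T = 0.
Proof.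
by move=> Vx; rewrite (jacobian_dot snu sf row_Nu row_F nu_f Vx) nu_normal // oppr0.
Qed.

Lemma metric_sym x : (g x)^T = g x.
Proof. by rewrite gE trmx_mul trmxK. Qed.

Lemma ginv_sym x : (G x)^T = G x.
Proof. by rewrite /ginv trmx_inv metric_sym. Qed.

Lemma mul_metricV x : V x -> g x *m G x = 1%:M.
Proof. by move=> Vx; rewrite mulmxV // g_unit. Qed.

Lemma mulV_metric x : V x -> G x *m g x = 1%:M.
Proof. by move=> Vx; rewrite mulVmx // g_unit. Qed.

Lemma hypersurface_frame x : V x ->
  (F x)^T *m G x *m F x + (f x)^T *m f x + (nu x)^T *m nu x = 1%:M.
Proof.
move=> Vx; apply: frame_decomposition.
- by rewrite -gE mul_metricV.
- exact: f_unit.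
- exact: nu_unit.
- exact: nu_f.
- exact: jacobian_position.
- exact: nu_normal.
Qed.

(** The entries are h_ij = - <d_i nu, d_j f>. *)
Definition second_form y : 'M[R]_d := - (Nu y *m (F y)^T).
Local Notation h := second_form.

Let sh : smooth_mx V h := smooth_oppmx V_open (smooth_mulmx V_open sNu sFT).

(** The entry in row j and column k is the Christoffel symbol Gamma^k_ij: the
    coefficient of d_k f in the tangential part of d_i d_j f. *)
Definition gam i y : 'M[R]_d := dmx i F y *m (F y)^T *m G y.

Lemma dF_normal_tr i x : V x -> dmx i F x *m (nu x)^T = col i (h x)^T.
Proof.
move=> Vx; rewrite (dmx_mul_cst V_open i sF snuT nu_normal Vx) dmx_tr.
by rewrite row_Nu_tr // /second_form raddfN /= trmx_mul trmxK col_mulmx raddfN.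
Qed.

Lemma dF_rowC i j x : V x -> row j (dmx i F x) = row i (dmx j F x).
Proof. by move=> Vx; exact: (dmx_rowC V_open i j sf row_F Vx). Qed.

Lemma dNu_rowC i j x : V x -> row j (dmx i Nu x) = row i (dmx j Nu x).
Proof. by move=> Vx; exact: (dmx_rowC V_open i j snu row_Nu Vx). Qed.

(** Differentiating <d_j f, nu> = 0 gives h_ij = <d_i d_j f, nu>. *)
Lemma second_form_sym x : V x -> (h x)^T = h x.
Proof.
move=> Vx; apply/matrixP => j i; rewrite [in RHS]/h.
have E a b : (h x)^T b a = (row b (dmx a F x) *m (nu x)^T) 0 0.
  by rewrite -row_mul dF_normal_tr // !mxE.
by rewrite E (dF_rowC _ _ Vx) -E [LHS]mxE.
Qed.

Lemma dF_normal i x : V x -> dmx i F x *m (nu x)^T = col i (h x).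
Proof. by move=> Vx; rewrite dF_normal_tr // second_form_sym. Qed.

Lemma dF_position i x : V x -> dmx i F x *m (f x)^T = - col i (g x).
Proof.
move=> Vx; rewrite (dmx_mul_cst V_open i sF sfT jacobian_position Vx) dmx_tr.
by rewrite row_F_tr // col_mulmx gE.
Qed.

(** Both second derivatives of f along the normal frame vectors are known from
    the derivatives of <d_j f, nu> = 0 and <d_j f, f> = 0. *)
Lemma gauss_formula i x : V x ->
  dmx i F x - gam i x *m F x = col i (h x) *m nu x - col i (g x) *m f x.
Proof.
move=> Vx; rewrite -[dmx i F x in LHS]mulmx1 -(hypersurface_frame Vx) !mulmxDr !mulmxA.
rewrite dF_position // dF_normal // /gam mulNmx addrAC [X in X + _]addrAC.
by rewrite subrr add0r addrC.
Qed.

Lemma gam_metric i x : V x -> gam i x *m g x = dmx i F x *m (F x)^T.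
Proof. by move=> Vx; rewrite /gam -mulmxA mulV_metric // mulmx1. Qed.

Lemma gam_rowC i j x : V x -> row j (gam i x) = row i (gam j x).
Proof. by move=> Vx; rewrite /gam !row_mul dF_rowC. Qed.

Lemma dmx_metric i x : V x ->
  dmx i g x = dmx i F x *m (F x)^T + (dmx i F x *m (F x)^T)^T.
Proof. move=> Vx; rewrite (eq_dmx V_open i (Y := fun y => F y *m (F y)^T)) //.
by rewrite (dmxM i sF sFT Vx) dmx_tr trmx_mul trmxK. Qed.

Lemma dmx_ginv i x : V x -> dmx i G x = - (G x *m gam i x) - (G x *m gam i x)^T.
Proof.
move=> Vx; rewrite (dmx_invmx V_open i g_unit sg Vx) dmx_metric // -/(ginv g x).
rewrite mulmxDr mulmxDl opprD /gam !trmx_mul !trmxK ginv_sym.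
by rewrite !mulmxA.
Qed.

(** With T a b c = <d_a d_b f, d_c f>, which is symmetric in a and b, the three
    derivatives of the metric are sums of six such terms, of which four cancel. *)
Lemma christoffelE k i j x : V x -> christoffel g k i j x = gam i x j k.
Proof.
move=> Vx; rewrite /christoffel /gam mxE mulr_sumr; apply: eq_bigr => l _.
pose T a b c := (dmx a F x *m (F x)^T) b c.
have dgE a b c : partial a (fun y => g y b c) x = T a b c + T a c b.
  have -> : partial a (fun y => g y b c) x = dmx a g x b c by rewrite dmxE.
  by rewrite dmx_metric // [LHS]mxE [X in _ + X]mxE.
have TC a b c : T a b c = T b a c.
  have E p q : T p q c = (row q (dmx p F x) *m (F x)^T) 0 c.
    by rewrite -row_mul [RHS]mxE.
  by rewrite !E dF_rowC.
have -> : ginv g x k l = G x l k by rewrite -[in LHS]ginv_sym [LHS]mxE.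
rewrite !dgE -/(T i j l) (TC i l) (TC j i) (TC j l).
set a := T i j l; set b := T l i j; set c := T l j i.
have -> : a + b + (a + c) - (b + c) = 2 * a by ring.
by rewrite mulrCA mulKf ?pnatr_eq0 // mulrC.
Qed.

(** The derivative of the inverse metric contributes two Christoffel terms; one
    cancels that of the divergence, and the other completes the derivative of
    the differential U of u to the Hessian of u. *)
Lemma laplacianE (u : 'rV[R]_d -> R) (U : 'rV[R]_d -> 'cV[R]_d) x :
  (forall y j, V y -> partial j u y = U y j 0) -> smooth_mx V U -> V x ->
  laplacian g u x = \sum_i (G x *m (dmx i U x - gam i x *m U x)) i 0.
Proof.
move=> uU sU Vx; rewrite /laplacian /divergence; apply: eq_bigr => i _.
have gradE j y : V y -> gradient g u j y = (G y *m U y) j 0.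
  by move=> Vy; rewrite /gradient mxE; apply: eq_bigr => k _; rewrite uU.
have -> : partial i (gradient g u i) x = dmx i (fun y => G y *m U y) x i 0.
  by rewrite dmxE; apply: (eq_on_derive V_open _ _ Vx) => y; exact: gradE.
have -> : \sum_j christoffel g i i j x * gradient g u j x
    = ((gam i x)^T *m (G x *m U x)) i 0.
  rewrite [RHS]mxE; apply: eq_bigr => j _.
  by rewrite christoffelE // gradE // [(gam i x)^T _ _]mxE.
have E : G x *m (dmx i U x - gam i x *m U x)
    = dmx i (fun y => G y *m U y) x + (gam i x)^T *m (G x *m U x).
  rewrite (dmxM i sG sU Vx) dmx_ginv // trmx_mul ginv_sym.
  by rewrite mulmxBl mulNmx mulmxBr !mulmxA addrAC subrK addrC.
by apply: etrans (esym (congr1 (fun M : 'cV[R]_d => M i 0) E)); rewrite [RHS]mxE.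
Qed.

(** The derivatives of nu are tangent to the hypersurface, so that only the
    tangential part of the frame decomposition remains. *)
Lemma weingarten x : V x -> Nu x = - (h x *m G x *m F x).
Proof.
move=> Vx; rewrite -[LHS]mulmx1 -(hypersurface_frame Vx) !mulmxDr !mulmxA.
rewrite jacobian_normal_position // jacobian_normal_normal // !mul0mx !addr0.
by rewrite /second_form !mulNmx opprK.
Qed.

Definition shape_mx y : 'M[R]_d := h y *m G y.
Local Notation A := shape_mx.

Lemma shape_jacobian x : V x -> A x *m F x = - Nu x.
Proof. by move=> Vx; rewrite /shape_mx [in RHS]weingarten // opprK. Qed.

Lemma shape_metric x : V x -> A x *m g x = h x.
Proof. by move=> Vx; rewrite /shape_mx -mulmxA mulV_metric // mulmx1. Qed.

Lemma shape_second_form_sym x : V x -> (A x *m h x)^T = A x *m h x.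
Proof.
by move=> Vx; rewrite /shape_mx !trmx_mul ginv_sym second_form_sym // mulmxA.
Qed.

Lemma tr_ginv_second_form x : V x -> \tr (G x *m h x) = \tr (A x).
Proof. by move=> Vx; rewrite /shape_mx mxtrace_mulC. Qed.

Lemma tr_ginv_shape x : V x -> \tr (G x *m (A x *m h x)) = \tr (A x *m A x).
Proof. by move=> Vx; rewrite mxtrace_mulC -mulmxA. Qed.

Lemma tr_ginv_metric x : V x -> \tr (G x *m g x) = d%:R.
Proof. by move=> Vx; rewrite mulV_metric // mxtrace1. Qed.

Lemma dNu_position i x : V x -> dmx i Nu x *m (f x)^T = col i (h x).
Proof.
move=> Vx; rewrite (dmx_mul_cst V_open i sNu sfT jacobian_normal_position Vx) dmx_tr.
by rewrite row_F_tr // col_mulmx /second_form raddfN.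
Qed.

Lemma dNu_normal i x : V x -> dmx i Nu x *m (nu x)^T = - col i (A x *m h x).
Proof.
move=> Vx; rewrite (dmx_mul_cst V_open i sNu snuT jacobian_normal_normal Vx) dmx_tr.
rewrite row_Nu_tr // col_mulmx; congr (- col i _).
rewrite weingarten // -/(shape_mx x) raddfN /= mulNmx mulmxN opprK trmx_mul.
rewrite !mulmxA -(mulmxA _ (F x)) -gE shape_metric //.
by rewrite /shape_mx trmx_mul ginv_sym second_form_sym // mulmxA.
Qed.

(** The covariant derivative of h in the i-th coordinate direction. *)
Definition covariant_second_form i y : 'M[R]_d :=
  dmx i h y - h y *m (gam i y)^T - gam i y *m h y.
Local Notation dh := covariant_second_form.

Lemma covariant_second_formE i x : V x ->
  dh i x = - (dmx i Nu x *m (F x)^T) - gam i x *m h x.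
Proof.
move=> Vx; rewrite /dh (dmxN i (smooth_mulmx V_open sNu sFT) Vx) (dmxM i sNu sFT Vx).
rewrite dmx_tr [in X in - (_ + X)]weingarten // -/(shape_mx x) mulNmx.
have -> : A x *m F x *m (dmx i F x)^T = h x *m (gam i x)^T.
  rewrite -mulmxA -[F x in LHS]trmxK -trmx_mul -gam_metric // trmx_mul metric_sym.
  by rewrite mulmxA shape_metric.
by rewrite opprD opprK addrK.
Qed.

Lemma covariant_second_form_sym i x : V x -> (dh i x)^T = dh i x.
Proof.
move=> Vx; rewrite /dh !raddfB /= (trmx_mul (h x)) (trmx_mul (gam i x)) trmxK.
rewrite second_form_sym // addrAC.
rewrite -dmx_tr (eq_dmx V_open i (Y := h)) // => y Vy.
exact: second_form_sym.
Qed.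

(** Once the derivative of h is written with the second derivatives of nu, the
    symmetry comes from that of d_i d_j nu and that of the Christoffel symbols. *)
Lemma codazzi i j x : V x -> row j (dh i x) = row i (dh j x).
Proof.
move=> Vx; rewrite (covariant_second_formE i Vx) (covariant_second_formE j Vx).
by rewrite !row_mulNB (dNu_rowC i j Vx) (gam_rowC i j Vx).
Qed.

(* Q is a right inverse of F; it turns an ambient vector into the coordinates of
   its tangential part. *)
Let Q y := (F y)^T *m G y.
Let sQ : smooth_mx V Q := smooth_mulmx V_open sFT sG.

Lemma jacobianQ x : V x -> F x *m Q x = 1%:M.
Proof. by move=> Vx; rewrite mulmxA -gE mul_metricV. Qed.

Definition riemann_mx i j x : 'M[R]_d :=
  dmx i (gam j) x - dmx j (gam i) x + (gam j x *m gam i x - gam i x *m gam j x).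

Lemma riemannE l k i j x : V x -> riemann g l k i j x = riemann_mx i j x k l.
Proof.
move=> Vx; have E a b : partial a (christoffel g l b k) x = dmx a (gam b) x k l.
  rewrite dmxE; apply: (eq_on_derive V_open _ _ Vx) => y Vy.
  exact: christoffelE.
rewrite /riemann !E.
transitivity (dmx i (gam j) x k l - dmx j (gam i) x k l
    + ((gam j x *m gam i x) k l - (gam i x *m gam j x) k l)); last by rewrite !mxE.
congr (_ + _); rewrite sumrB; congr (_ - _).
  by rewrite [RHS]mxE; apply: eq_bigr => m _; rewrite !christoffelE // mulrC.
by rewrite [RHS]mxE; apply: eq_bigr => m _; rewrite !christoffelE // mulrC.
Qed.

(** The third derivatives of f cancel.  What is left factors through 1 - Q F, the
    orthogonal projection onto the span of f and nu: the position f contributes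
    the curvature of the sphere, and nu the quadratic terms in h. *)
Lemma gauss_equation i j x : V x -> riemann_mx i j x =
  (col j (g x) *m row i 1%:M - col i (g x) *m row j 1%:M)
  + (col j (h x) *m row i (A x) - col i (h x) *m row j (A x)).
Proof.
move=> Vx.
have dgam a b : dmx a (gam b) x = dmx a (dmx b F) x *m Q x + dmx b F x *m dmx a Q x.
  rewrite -(dmxM a (smooth_dmx V_open b sF) sQ Vx).
  by apply: (eq_dmx V_open a _ Vx) => y _; rewrite /gam -mulmxA.
have fQ y : V y -> f y *m Q y = 0.
  by move=> Vy; rewrite mulmxA -[f y]trmxK -trmx_mul jacobian_position // trmx0 mul0mx.
have nuQ y : V y -> nu y *m Q y = 0.
  by move=> Vy; rewrite mulmxA -[nu y]trmxK -trmx_mul nu_normal // trmx0 mul0mx.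
have fdQ a : f x *m dmx a Q x = - row a 1%:M.
  rewrite -[LHS]opprK -(dmx_mul_cst V_open a sf sQ fQ Vx) -row_F //.
  by rewrite -row_mul jacobianQ.
have nudQ a : nu x *m dmx a Q x = row a (A x).
  rewrite -[LHS]opprK -(dmx_mul_cst V_open a snu sQ nuQ Vx) -row_Nu //.
  rewrite -row_mul -raddfN /=; congr (row a _).
  by rewrite mulmxA -mulNmx.
have FdQ a : dmx a F x *m Q x = - (F x *m dmx a Q x).
  exact: (dmx_mul_cst V_open a sF sQ jacobianQ Vx).
have gg a b : gam a x *m gam b x = - (dmx a F x *m Q x *m F x *m dmx b Q x).
  have gamE c : gam c x = dmx c F x *m Q x by rewrite /gam -mulmxA.
  by rewrite !gamE (FdQ b) mulmxN !mulmxA.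
have term a b : dmx b F x *m dmx a Q x - dmx b F x *m Q x *m F x *m dmx a Q x
    = col b (g x) *m row a 1%:M + col b (h x) *m row a (A x).
  rewrite -[dmx b F x in X in X - _]mulmx1 -(hypersurface_frame Vx).
  rewrite !mulmxDr !mulmxDl !mulmxA dF_position // dF_normal //.
  rewrite mulNmx mulNmx -(mulmxA _ (f x)) -(mulmxA _ (nu x)) fdQ nudQ mulmxN opprK.
  by rewrite addrAC [X in X + _]addrAC subrr add0r.
rewrite /riemann_mx !dgam (dmx_comm V_open j i sF Vx) !gg.
have regroup (Z : zmodType) (a b c p q : Z) :
    a + b - (a + c) + (- p - - q) = (b - p) - (c - q).
  by rewrite opprK opprD (addrACA a) subrr add0r addrACA opprB (addrC q).
by rewrite regroup !term opprD addrACA.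
Qed.

Lemma ricciE j k x : V x ->
  ricci g j k x = (d%:R - 1) * g x k j + h x k j * \tr (A x) - (A x *m h x) j k.
Proof.
move=> Vx; rewrite /ricci.
have term i : riemann g i k i j x = (g x k j - (g x k i) * (j == i)%:R)
    + (h x k j * A x i i - A x j i * h x i k).
  rewrite riemannE // gauss_equation //.
  have hk : h x k i = h x i k by rewrite -[in LHS]second_form_sym // mxE.
  have entry (P Q' P' Q'' : 'M[R]_d) a b :
      (P - Q' + (P' - Q'')) a b = P a b - Q' a b + (P' a b - Q'' a b) by rewrite !mxE.
  rewrite entry !mul_col_rowE -hk (mulrC (A x j i)).
  by rewrite [1%:M i i]mxE [1%:M j i]mxE eqxx mulr1.
rewrite (eq_bigr _ (fun i _ => term i)) big_split !sumrB /= -mulr_sumr.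
have -> : \sum_i g x k i * (j == i)%:R = g x k j.
  rewrite (bigD1 j) //= eqxx mulr1 big1 ?addr0 // => i.
  by rewrite eq_sym => /negPf ->; rewrite mulr0.
rewrite sumr_const card_ord -[g x k j *+ d]mulr_natl mulrBl mul1r addrA; congr (_ - _).
by rewrite [RHS]mxE.
Qed.

Lemma scalar_curvatureE x : V x -> \tr (A x) = 0 ->
  scalar_curvature g x = d%:R * (d%:R - 1) - \tr (A x *m A x).
Proof.
move=> Vx trA; rewrite /scalar_curvature -tr_ginv_shape // -[X in X * _](tr_ginv_metric Vx).
rewrite /mxtrace mulr_suml -sumrB; apply: eq_bigr => j _.
rewrite [(_ *m g x) j j]mxE [(_ *m (_ *m h x)) j j]mxE mulr_suml -sumrB.
apply: eq_bigr => k _.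
have sym : (A x *m h x) j k = (A x *m h x) k j.
  by rewrite -[in LHS]shape_second_form_sym // [LHS]mxE.
rewrite ricciE // trA mulr0 addr0 sym mulrBr; congr (_ - _).
by rewrite mulrCA mulrC.
Qed.

Section Minimal.
Hypothesis traceless : forall x, V x -> \tr (A x) = 0.

Lemma trace_covariant_second_form k x : V x -> \tr (G x *m dh k x) = 0.
Proof.
move=> Vx; have : \tr (dmx k (fun y => G y *m h y) x) = 0.
  rewrite (dmx_trace k (smooth_mulmx V_open sG sh) Vx) /partial.
  rewrite (eq_on_derive V_open (g := fun=> 0)) ?derive_cst // => y Vy.
  by rewrite tr_ginv_second_form // traceless.
by rewrite (dmxM k sG sh Vx) dmx_ginv // -mxtrace_covariant // ginv_sym.
Qed.

(** Each coordinate of f is an eigenfunction: the trace of the Gauss formula is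
    (tr A) nu - d f. *)
Lemma tension_position x : V x ->
  \sum_i row i (G x *m (dmx i F x - gam i x *m F x)) = - d%:R *: f x.
Proof.
move=> Vx.
rewrite (eq_bigr (fun i => row i (G x *m (col i (h x) *m nu x))
   - row i (G x *m (col i (g x) *m f x)))); last first.
  by move=> i _; rewrite gauss_formula // mulmxBr raddfB.
rewrite sumrB !sum_row_mul_col tr_ginv_second_form // traceless // tr_ginv_metric //.
by rewrite scale0r sub0r scaleNr.
Qed.

(** Each coordinate of nu is an eigenfunction: among the frame components of the
    Hessian of nu, the tangential ones are minus the covariant derivative of h,
    whose trace is the differential of tr A by codazzi. *)
Lemma tension_normal x : V x ->
  \sum_i row i (G x *m (dmx i Nu x - gam i x *m Nu x))
  = - \tr (A x *m A x) *: nu x.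
Proof.
move=> Vx.
have E i : dmx i Nu x - gam i x *m Nu x = - (dh i x *m (G x *m F x))
    + col i (h x) *m f x - col i (A x *m h x) *m nu x.
  set X := LHS; rewrite -[X]mulmx1 -(hypersurface_frame Vx) !mulmxDr !mulmxA.
  have -> : X *m (F x)^T = - dh i x.
    rewrite covariant_second_formE // /X mulmxBl.
    by rewrite -(mulmxA (gam i x)) /h mulmxN opprD !opprK.
  have -> : X *m (f x)^T = col i (h x).
    rewrite /X mulmxBl dNu_position //.
    by rewrite -(mulmxA (gam i x)) jacobian_normal_position // mulmx0 subr0.
  have -> : X *m (nu x)^T = - col i (A x *m h x).
    rewrite /X mulmxBl dNu_normal //.
    by rewrite -(mulmxA (gam i x)) jacobian_normal_normal // mulmx0 subr0.
  by rewrite !mulNmx -!mulmxA.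
rewrite (eq_bigr (fun i => - (row i (G x *m dh i x) *m (G x *m F x))
   + row i (G x *m (col i (h x) *m f x))
   - row i (G x *m (col i (A x *m h x) *m nu x)))); last first.
  move=> i _; rewrite E mulmxBr mulmxDr mulmxN raddfB raddfD raddfN /=.
  by rewrite (mulmxA (G x) (dh i x)) (row_mul i (G x *m dh i x)).
rewrite sumrB big_split /= !sum_row_mul_col sumrN -mulmx_suml.
rewrite (partial_trace_sym3 _ (fun i => covariant_second_form_sym i Vx)
  (fun i j => codazzi i j Vx)).
rewrite tr_ginv_second_form // traceless // tr_ginv_shape //.
have -> : \row_k \tr (G x *m dh k x) = 0.
  by apply/rowP => k; rewrite !mxE trace_covariant_second_form.
by rewrite mul0mx oppr0 scale0r !add0r scaleNr.
Qed.

(** The function is the pairing of the bivector f wedge nu with S.  The second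
    derivatives of f and nu give the two eigenvalues d and |A|^2.  The cross
    terms are traces of a symmetric matrix (built from h) times the skew matrix
    F S F^T, hence 0. *)
Lemma laplacian_wedge (S : 'M[R]_(d + 2)) x : S^T = - S -> V x ->
  laplacian g (fun y => (f y *m S *m (nu y)^T) 0 0) x
  = - (d%:R + \tr (A x *m A x)) * (f x *m S *m (nu x)^T) 0 0.
Proof.
move=> skewS Vx; have sS : smooth_mx V (fun=> S) := smooth_cst_mx V_open S.
have sfS : smooth_mx V (fun y => f y *m S) := smooth_mulmx V_open sf sS.
have sFS : smooth_mx V (fun y => F y *m S) := smooth_mulmx V_open sF sS.
have sNuS : smooth_mx V (fun y => Nu y *m S) := smooth_mulmx V_open sNu sS.
pose U1 y := F y *m S *m (nu y)^T; pose U2 y := Nu y *m S *m (f y)^T.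
have sU1 : smooth_mx V U1 := smooth_mulmx V_open sFS snuT.
have sU2 : smooth_mx V U2 := smooth_mulmx V_open sNuS sfT.
have sU : smooth_mx V (fun y => U1 y - U2 y) := smooth_addmx V_open sU1 (smooth_oppmx V_open sU2).
have uU y j : V y ->
    partial j (fun y => (f y *m S *m (nu y)^T) 0 0) y = (U1 y - U2 y) j 0.
  move=> Vy; transitivity (dmx j (fun y => f y *m S *m (nu y)^T) y 0 0).
    by rewrite dmxE.
  transitivity (row j (U1 y - U2 y) 0 0); last by rewrite mxE.
  congr (fun_of_matrix _ 0 0).
  rewrite (dmxM j sfS snuT Vy) (dmxMr V_open j S sf Vy) dmx_tr.
  rewrite -row_F // -row_Nu //.
  rewrite [RHS]raddfB /= /U1 /U2 !row_mul; congr (_ + _).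
  by rewrite -[LHS]trmx11 !trmx_mul trmxK skewS mulNmx mulmxN mulmxA.
rewrite (laplacianE uU sU Vx).
have dU i : dmx i (fun y => U1 y - U2 y) x
    = dmx i F x *m S *m (nu x)^T + F x *m S *m col i (Nu x)^T
      - (dmx i Nu x *m S *m (f x)^T + Nu x *m S *m col i (F x)^T).
  rewrite (dmxD i sU1 (smooth_oppmx V_open sU2) Vx) (dmxN i sU2 Vx).
  rewrite (dmxM i sFS snuT Vx) (dmxMr V_open i S sF Vx).
  rewrite (dmxM i sNuS sfT Vx) (dmxMr V_open i S sNu Vx).
  rewrite (dmx_tr i nu) (dmx_tr i f).
  by rewrite row_F_tr // row_Nu_tr.
have step i : row i (G x *m (dmx i (fun y => U1 y - U2 y) x - gam i x *m (U1 x - U2 x)))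
   = row i (G x *m (dmx i F x - gam i x *m F x)) *m (S *m (nu x)^T)
     - row i (G x *m (dmx i Nu x - gam i x *m Nu x)) *m (S *m (f x)^T)
     + (row i (G x *m (col i (F x *m S *m (Nu x)^T)))
        - row i (G x *m (col i (Nu x *m S *m (F x)^T)))).
  by rewrite dU tension_split row_mulB !col_mulmx.
have skew_conj : (F x *m S *m (F x)^T)^T = - (F x *m S *m (F x)^T).
  by rewrite !trmx_mul trmxK skewS mulNmx mulmxN mulmxA.
have symGhG : (G x *m A x)^T = G x *m A x.
  by rewrite /shape_mx !trmx_mul !ginv_sym second_form_sym // mulmxA.
have two : 2%:R != 0 :> R by rewrite pnatr_eq0.
have tr1 : \tr (G x *m (F x *m S *m (Nu x)^T)) = 0.
  rewrite weingarten // -/(shape_mx x) raddfN /= trmx_mul !mulmxN raddfN /=.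
  rewrite -[RHS]oppr0 -(mxtrace_sym_skew two symGhG skew_conj); congr (- _).
  by rewrite -[in RHS]symGhG (trmx_mul (G x)) ginv_sym !mulmxA [LHS]mxtrace_mulC !mulmxA.
have tr2 : \tr (G x *m (Nu x *m S *m (F x)^T)) = 0.
  rewrite weingarten // -/(shape_mx x) !mulNmx mulmxN raddfN /=.
  rewrite -[RHS]oppr0 -(mxtrace_sym_skew two symGhG skew_conj); congr (- _).
  by rewrite !mulmxA.
have flip : nu x *m (S *m (f x)^T) = - (f x *m (S *m (nu x)^T)).
  by rewrite -[LHS]trmx11 !trmx_mul trmxK skewS mulmxN mulNmx mulmxA.
transitivity ((\sum_i row i
    (G x *m (dmx i (fun y => U1 y - U2 y) x - gam i x *m (U1 x - U2 x)))) 0 0).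
  rewrite summxE; apply: eq_bigr => i _; rewrite [RHS]mxE.
  reflexivity.
rewrite (eq_bigr _ (fun i _ => step i)) big_split /= !sumrB -!mulmx_suml.
rewrite tension_position // tension_normal // !sum_row_col tr1 tr2 subrr addr0.
rewrite -!scalemxAl flip scalerN -scaleNr opprK -scalerBl -opprD mulmxA.
by rewrite [LHS]mxE.
Qed.

End Minimal.

End LocalHypersurface.

(** * Minimal hypersurfaces in a chart *)

Section MinimalHypersurface.
Variables (R : realType) (d : nat) (V : set 'rV[R]_d).
Variables (f nu : 'rV[R]_d -> 'rV[R]_(d + 2)).
Hypothesis V_open : open V.
Hypotheses (f_smooth : smooth_on V f) (nu_smooth : smooth_on V nu).
Hypothesis f_unit : forall x, V x -> dot (f x) (f x) = 1.
Hypothesis nu_unit : forall x, V x -> dot (nu x) (nu x) = 1.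
Hypothesis nu_f : forall x, V x -> dot (nu x) (f x) = 0.
Hypothesis f_immersed : forall x, V x -> row_free ('J f x).
Hypothesis nu_normal : forall x, V x -> 'J f x *m (nu x)^T = 0.

Local Notation F := (fun y => 'J f y).
Local Notation Nu := (fun y => 'J nu y).
Local Notation g := (induced_metric f).
Local Notation A := (shape_operator f nu).

Let sf := smooth_rv V_open f_smooth.
Let snu := smooth_rv V_open nu_smooth.
Let sF := smooth_jacobian V_open f_smooth.
Let sNu := smooth_jacobian V_open nu_smooth.
Let gE x : g x = F x *m (F x)^T. Proof. by []. Qed.

Lemma dotE m (u v : 'rV[R]_m) c : dot u v = c -> u *m v^T = c%:M.
Proof. by move=> <-; exact: mx11_scalar. Qed.

Let ff x (Vx : V x) : f x *m (f x)^T = 1%:M := dotE (f_unit Vx).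
Let nn x (Vx : V x) : nu x *m (nu x)^T = 1%:M := dotE (nu_unit Vx).
Let nf x (Vx : V x) : nu x *m (f x)^T = 0.
Proof. by rewrite (dotE (nu_f Vx)) raddf0. Qed.

Let rowF i x (Vx : V x) := row_jacobian f_smooth i Vx.
Let rowNu i x (Vx : V x) := row_jacobian nu_smooth i Vx.

Lemma sphere_nablaE x : V x -> sphere_nabla f nu x = 'J nu x.
Proof.
move=> Vx; rewrite /sphere_nabla mulmxBr mulmx1 mulmxA.
rewrite (jacobian_normal_position V_open sf snu rowF rowNu nf nu_normal Vx).
by rewrite mul0mx subr0.
Qed.

Lemma shape_operatorE x : V x -> A x = shape_mx F Nu g x.
Proof.
move=> Vx; rewrite /shape_operator sphere_nablaE //.
rewrite -(shape_jacobian V_open sf snu rowF rowNu gE ff nn nf f_immersed nu_normal Vx).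
by rewrite -mulmxA (mulmxVp (f_immersed Vx)) mulmx1.
Qed.

Lemma scalar_curvature_minimal x : V x -> \tr (A x) = 0 ->
  scalar_curvature g x = d%:R * (d%:R - 1) - \tr (A x *m A x).
Proof.
move=> Vx; rewrite shape_operatorE // => trA.
exact: (scalar_curvatureE V_open sf snu sF rowF rowNu gE ff nn nf f_immersed
  nu_normal Vx trA).
Qed.

Hypothesis traceless : forall x, V x -> \tr (A x) = 0.

Lemma laplacian_minimal (S : 'M[R]_(d + 2)) x : S^T = - S -> V x ->
  laplacian g (fun y => (f y *m S *m (nu y)^T) 0 0) x
  = - (d%:R + \tr (A x *m A x)) * (f x *m S *m (nu x)^T) 0 0.
Proof.
move=> skewS Vx; rewrite shape_operatorE //.
have trA y : V y -> \tr (shape_mx F Nu g y) = 0.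
  by move=> Vy; rewrite -shape_operatorE // traceless.
exact: (laplacian_wedge V_open sf snu sF sNu rowF rowNu gE ff nn nf f_immersed
  nu_normal trA skewS Vx).
Qed.

Lemma smooth_wedge (S : 'M[R]_(d + 2)) :
  smooth_on V (fun y => (f y *m S *m (nu y)^T) 0 0).
Proof.
exact: (smooth_mulmx V_open (smooth_mulmx V_open sf (smooth_cst_mx V_open S))
  (smooth_trmx V_open snu) 0 0).
Qed.

End MinimalHypersurface.

(** * The eigenvalue |A|^2 + 6 *)

Theorem theorem1p5 (R : realType) (M : topologicalType)
    (At : oriented_atlas R M 6) (phi N : M -> 'rV[R]_8)
    (M_nonempty : [set: M] !=set0)
    (M_hausdorff : hausdorff_space M)
    (M_compact : compact [set: M])
    (phi_immersion : sphere_immersion At phi)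
    (N_normal : unit_normal_field At phi N)
    (M_minimal : minimal At phi N)
    (M_csc : constant_scalar_curvature At phi)
    (A_gt6 : forall i x, cod (At i) x -> 6 < chart_shape_norm2 phi N i x) :
  exists lambda : R,
    [/\ 12 < lambda,
        laplace_eigenvalue At phi lambda
      & forall i x, cod (At i) x -> chart_shape_norm2 phi N i x = lambda - 6].
Proof.
have [phi_smooth phi_unit phi_free] := phi_immersion.
have [N_smooth N_unit N_phi N_orth] := N_normal.
have [c scal_c] := M_csc.
have trE i x : cod (At i) x -> chart_shape_norm2 phi N i x
    = \tr (chart_shape phi N i x *m chart_shape phi N i x).
  by move=> Vx; apply: shape_norm2E; apply: lt_trans (A_gt6 i x Vx).
(* 30 = 6 * (6 - 1), the scalar curvature of the unit 6-sphere. *)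
have scalE i x : cod (At i) x -> chart_shape_norm2 phi N i x = 30 - c.
  move=> Vx; rewrite trE // -(scal_c i x Vx).
  have := @scalar_curvature_minimal R 6 _ (phi \o bwd (At i)) (N \o bwd (At i))
    (cod_open (c := At i)) (phi_smooth i) (N_smooth i) (fun y _ => phi_unit _)
    (fun y _ => N_unit _) (fun y _ => N_phi _) (phi_free i) (N_orth i) x Vx
    (M_minimal i x Vx).
  by rewrite -/(chart_metric phi i) -/(chart_shape phi N i) => ->; ring.
have [p0 _] := M_nonempty; have [i0 dom_p0] := atlas_cover At p0.
have gt6 := A_gt6 i0 _ (fwd_cod dom_p0).
rewrite (scalE _ _ (fwd_cod dom_p0)) in gt6.
exists (30 - c + 6); split; [lra | | by move=> i x Vx; rewrite addrK scalE].
(* Pairing with the bivector phi wedge N at p0 itself gives a function with value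
   |phi wedge N|^2 = 1 at p0. *)
pose S : 'M[R]_8 := (phi p0)^T *m N p0 - (N p0)^T *m phi p0.
have skewS : S^T = - S by rewrite /S raddfB /= !trmx_mul !trmxK opprB.
exists (fun p => (phi p *m S *m (N p)^T) 0 0); split.
- move=> i; exact: (@smooth_wedge R 6 _ (phi \o bwd (At i)) (N \o bwd (At i))
    (cod_open (c := At i)) (phi_smooth i) (N_smooth i) S).
- exists p0.
  have pp := dotE (phi_unit p0); have NN := dotE (N_unit p0).
  have Np := dotE (N_phi p0).
  have pN : phi p0 *m (N p0)^T = 0.
    by rewrite -[LHS]trmxK trmx_mul trmxK Np raddf0 trmx0.
  rewrite /S mulmxBr !mulmxA pp pN mul0mx subr0 mul1mx NN mxE eqxx.
  exact: oner_neq0.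
move=> i x Vx.
have := @laplacian_minimal R 6 _ (phi \o bwd (At i)) (N \o bwd (At i))
    (cod_open (c := At i)) (phi_smooth i) (N_smooth i) (fun y _ => phi_unit _)
    (fun y _ => N_unit _) (fun y _ => N_phi _) (phi_free i) (N_orth i)
    (M_minimal i) S x skewS Vx.
rewrite -/(chart_shape phi N i) -trE // scalE // (addrC 6).
exact.
Qed.
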